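(* Let $x\in\mathcal M_h$, $y\in\mathcal M_H$, and let $q:\mathcal C_y\to\mathbb R$ be the objective of the Riemannian coarse model, $$q(z)=f_H(z)-\langle w,\mathcal L^H_y(z)\rangle_y,\qquad w=\operatorname{grad} f_H(y)-R_x^y(\operatorname{grad} f_h(x)).$$ Then $$\operatorname{grad} q(y)=R_x^y\big(\operatorname{grad} f_h(x)\big).$$
   Context: Setting. $V_H,V_h$ are finite-dimensional Euclidean spaces, $\mathcal M_H\subset V_H$ (coarse) and $\mathcal M_h\subset V_h$ (fine) are Riemannian manifolds with metrics written $\langle\cdot,\cdot\rangle_y$ ($y\in\mathcal M_H$) and $\langle\cdot,\cdot\rangle_x$ ($x\in\mathcal M_h$). $f_H:\mathcal M_H\to\mathbb R$ and $f_h:\mathcal M_h\to\mathbb R$ are continuously differentiable; $\operatorname{grad}$ denotes the Riemannian gradient. Retraction and lifting. $\mathcal R^H$ is a retraction on $\mathcal M_H$: smooth maps $\mathcal R^H_y:\mathrm T_y\mathcal M_H\to\mathcal M_H$ with $\mathcal R^H_y(0)=y$, $\mathrm D\mathcal R^H_y(0)=\mathrm{id}$. The lifting map $\mathcal L^H_y=(\mathcal R^H_y)^{-1}:\mathcal U_y\to\mathrm T_y\mathcal M_H$ is the smooth inverse of the restriction of $\mathcal R^H_y$ to an open neighborhood of $0$ which $\mathcal R_y^H$ maps diffeomorphically onto an open neighborhood $\mathcal U_y$ of $y$. A set $\mathcal C\subset\mathcal M_H$ is $\mathcal R^H$-convex if for all $a,b\in\mathcal C$ the vector $v=\mathcal L^H_a(b)$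 exists (i.e. $b\in\mathcal U_a$) and $\mathcal R^H_a(tv)\in\mathcal C$ for all $t\in[0,1]$. $\mathcal C_y\subset\mathcal M_H$ is an $\mathcal R^H$-convex set containing $y$ on which $\mathcal L_y^H$ is well defined, i.e. $\mathcal C_y\subset\mathcal U_y$. Derivatives of $q$ at points of $\mathcal C_y$ are those of its defining formula on the open set $\mathcal U_y$. Vector transfer operators. $P_y^x:\mathrm T_y\mathcal M_H\to\mathrm T_x\mathcal M_h$ is an injective linear map (vector prolongation) and $R_x^y:\mathrm T_x\mathcal M_h\to\mathrm T_y\mathcal M_H$ is a surjective linear map (vector restriction) satisfying the geometric Galerkin condition $\langle P_y^xu,v\rangle_x=\langle u,R_x^yv\rangle_y$ for all $u\in\mathrm T_y\mathcal M_H$, $v\in\mathrm T_x\mathcal M_h$. *)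

(* Defs.v *)
From HB Require Import structures.
From mathcomp Require Import all_boot all_order all_algebra.
From mathcomp Require Import all_classical all_reals all_analysis.
Set Implicit Arguments.
Unset Strict Implicit.
Unset Printing Implicit Defensive.
Import Order.TTheory GRing.Theory Num.Theory.
Import numFieldNormedType.Exports.
Local Open Scope classical_set_scope.
Local Open Scope ring_scope.

(* Manifolds, tangent spaces, metrics, ... are given by
   sets, relations and total functions on the ambient space 'rV[R]_n: a map
   defined only on a set S (or a tensor defined only on tangent vectors) is
   represented by a total function of which only the values on S matter. *)

Section Regularity.
Context {R : realType} {V W : normedModType R}.
Implicit Types (S U : set V) (f : V -> W).

(* Class C^k on an open set U; faithful for finite-dimensional V, where
   continuity of all directional derivatives is continuity of the
   differential. *)
Fixpoint Ck (k : nat) U f : Prop :=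
  match k with
  | 0%N => forall x, U x -> {for x, continuous f}
  | k'.+1 => (forall x, U x -> differentiable f x) /\
             (forall v, Ck k' U (fun x => 'd f x v))
  end.

Definition smooth U f := forall k, Ck k U f.

(* Regularity on a not necessarily open set, by local extension. *)
Definition extends_locally (P : set V -> (V -> W) -> Prop) S f :=
  forall x, S x -> exists (O : set V) (F : V -> W),
    [/\ open O, O x, P O F & forall z, O z -> S z -> F z = f z].

Definition smooth_on S f := extends_locally smooth S f.

Definition C1_on S f := extends_locally (Ck 1) S f.

End Regularity.

Section Submanifolds.
Context {R : realType} {n : nat}.
Local Notation V := 'rV[R]_n.
Implicit Types (M : set V) (x y v : V).

(* Embedded smooth submanifold of dimension d: around each of its points
   there is a diffeomorphism F of open subsets of V, with inverse G, which
   straightens M to the subspace spanned by the first d coordinates. *)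
Definition embedded_submanifold (d : nat) M :=
  (d <= n)%N /\
  forall x, M x -> exists (O O' : set V) (F G : V -> V),
    [/\ open O, O x & open O'] /\
    [/\ smooth O F, smooth O' G,
        forall z, O z -> O' (F z) /\ G (F z) = z &
        forall z, O' z -> O (G z) /\ F (G z) = z] /\
    forall z, O z ->
      (M z <-> forall i : 'I_n, (d <= i)%N -> F z 0 i = 0).

Definition curve_through M x (c : R -> V) :=
  c 0 = x /\
  exists2 e : R, 0 < e &
    smooth (ball (0 : R) e) c /\ forall t, ball (0 : R) e t -> M (c t).

Definition tangent M x : set V :=
  [set v | exists2 c, curve_through M x c & is_derive (0 : R) 1 c v].

(* D f(x)[v] = A v for every v tangent to M at x, where
   D f(x)[v] = (f \o c)'(0) for any curve c on M with c(0) = x, c'(0) = v.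
   This depends only on the values of f on M near x. *)
Definition has_differential {W : normedModType R} M (f : V -> W) x
    (A : V -> W) :=
  forall c v, curve_through M x c -> is_derive (0 : R) 1 c v ->
    is_derive (0 : R) 1 (f \o c) (A v).

Definition inner_product_on (T : set V) (g : V -> V -> R) :=
  [/\ forall (a : R) u v w, T u -> T v -> T w ->
        g (a *: u + v) w = a * g u w + g v w,
      forall u v, T u -> T v -> g u v = g v u &
      forall u, T u -> u != 0 -> 0 < g u u].

Definition vector_field M (X : V -> V) := forall z, M z -> tangent M z (X z).

(* g x u v stands for <u, v>_x. *)
Definition riemannian_metric M (g : V -> V -> V -> R) :=
  (forall x, M x -> inner_product_on (tangent M x) (g x)) /\
  (forall X Y, vector_field M X -> smooth_on M X ->
     vector_field M Y -> smooth_on M Y ->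
     smooth_on M (fun z => g z (X z) (Y z))).

Definition is_gradient M (g : V -> V -> V -> R) (f : V -> R) x (G : V) :=
  tangent M x G /\ has_differential M f x (g x G).

(* The Riemannian gradient; 0 if f has no gradient at x. *)
Definition grad M (g : V -> V -> V -> R) (f : V -> R) x : V :=
  xget 0 [set G | is_gradient M g f x G].

(* Ret y v stands for R_y(v). *)
Definition retraction M (Ret : V -> V -> V) :=
  forall y, M y ->
    [/\ forall v, tangent M y v -> M (Ret y v),
        smooth_on (tangent M y) (Ret y),
        Ret y 0 = y &
        has_differential (tangent M y) (Ret y) 0 id].

Definition relatively_open (S A : set V) :=
  exists2 O : set V, open O & A = S `&` O.

(* L y z stands for L_y(z), with domain U y. *)
Definition lifting M (Ret : V -> V -> V) (U : V -> set V)
    (L : V -> V -> V) :=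
  forall y, M y -> exists D : set V,
    [/\ relatively_open (tangent M y) D, D 0,
        relatively_open M (U y) & U y y] /\
    [/\ forall v, D v -> U y (Ret y v) /\ L y (Ret y v) = v,
        forall z, U y z -> D (L y z) /\ Ret y (L y z) = z &
        smooth_on (U y) (L y)].

Definition retraction_convex (Ret : V -> V -> V) (U : V -> set V)
    (L : V -> V -> V) (C : set V) :=
  forall a b, C a -> C b ->
    U a b /\ forall t : R, 0 <= t <= 1 -> C (Ret a (t *: L a b)).

End Submanifolds.

Definition linear_between {R : realType} {m n : nat}
    (T : set 'rV[R]_m) (T' : set 'rV[R]_n) (A : 'rV[R]_m -> 'rV[R]_n) :=
  (forall u, T u -> T' (A u)) /\
  (forall (a : R) u v, T u -> T v -> A (a *: u + v) = a *: A u + A v).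

Section CoarseModel.
Context {R : realType} {m n : nat}.

(* P : T -> T' is the prolongation, Q : T' -> T the restriction, g and g'
   are the inner products on T and T'. *)
Definition vector_transfer
    (T : set 'rV[R]_m) (g : 'rV[R]_m -> 'rV[R]_m -> R)
    (T' : set 'rV[R]_n) (g' : 'rV[R]_n -> 'rV[R]_n -> R)
    (P : 'rV[R]_m -> 'rV[R]_n) (Q : 'rV[R]_n -> 'rV[R]_m) :=
  [/\ linear_between T T' P,
      forall u v, T u -> T v -> P u = P v -> u = v,
      linear_between T' T Q,
      forall u, T u -> exists2 v, T' v & Q v = u &
      forall u v, T u -> T' v -> g' (P u) v = g u (Q v)].

(* The formula defining q; meaningful on U_y, which contains C_y. *)
Definition coarse_objective
    (MH : set 'rV[R]_m) (gH : 'rV[R]_m -> 'rV[R]_m -> 'rV[R]_m -> R)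
    (fH : 'rV[R]_m -> R) (L : 'rV[R]_m -> 'rV[R]_m -> 'rV[R]_m)
    (Mh : set 'rV[R]_n) (gh : 'rV[R]_n -> 'rV[R]_n -> 'rV[R]_n -> R)
    (fh : 'rV[R]_n -> R) (Q : 'rV[R]_n -> 'rV[R]_m)
    (x : 'rV[R]_n) (y : 'rV[R]_m) (z : 'rV[R]_m) : R :=
  let w := grad MH gH fH y - Q (grad Mh gh fh x) in
  fH z - gH y w (L y z).

End CoarseModel.

(* Main.v *)
From HB Require Import structures.
Require Import Defs.
From mathcomp Require Import all_boot all_order all_algebra.
From mathcomp Require Import all_classical all_reals all_analysis.
Set Implicit Arguments.
Unset Strict Implicit.
Unset Printing Implicit Defensive.
Import Order.TTheory GRing.Theory Num.Theory.
Import numFieldNormedType.Exports.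
Local Open Scope classical_set_scope.
Local Open Scope ring_scope.

(** The retraction R_y has differential id at 0, so its local inverse L_y has
    differential id at y ([lifting_differential]). The model q is therefore
    f_H minus a map whose differential at y is v |-> <w, v>_y, and
    D q(y)[v] = <grad f_H(y) - w, v>_y = <R_x^y (grad f_h(x)), v>_y.

    The rest makes this computation legitimate.

    - A differential on a manifold is tested on smooth curves through the
      point. A chart shows that the tangent space, defined by velocities of
      such curves, is a linear subspace ([tangent_rowspace]), here the row
      space of a matrix. Row spaces are closed, so the velocity of a curve
      lying in one stays in it, and a form that is linear only on the
      subspace can be differentiated along such a curve
      ([is_derive1_linear_form_on]); this covers t |-> <w, L_y(c t)>_y.

    - [grad] is a choice among the gradients, so it represents the
      differential only if a gradient exists, which follows from the Riesz
      representation theorem on the tangent space ([rowspace_riesz],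
      [grad_is_gradient]). Uniqueness ([is_gradient_unique]) turns the
      statement that R_x^y (grad f_h(x)) is a gradient of q at y into the
      equation. *)

(** * Derivatives along curves *)

Lemma is_derive1_comp (R : realType) (V W : normedModType R) (F : V -> W)
    (c : R -> V) (t : R) (a : V) :
  differentiable F (c t) -> is_derive t 1 c a ->
  is_derive t 1 (F \o c) ('d F (c t) a).
Proof.
move=> dF [dc ca]; have dc' : differentiable c t by apply/derivable1_diffP.
have dFc : differentiable (F \o c) t by exact: differentiable_comp.
apply: DeriveDef; first exact/derivable1_diffP.
by rewrite deriveE // diff_comp //= -ca deriveE.
Qed.

Lemma is_diff_affine (R : realType) (V : normedModType R) (p w : V) (t : R) :
  is_diff t (fun s : R => p + s *: w) ( *:%R ^~ w).
Proof. by rewrite -[X in is_diff _ _ X]add0r; apply: is_diffD. Qed.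

Lemma is_derive1_affine (R : realType) (V : normedModType R) (p w : V) (t : R) :
  is_derive t 1 (fun s : R => p + s *: w) w.
Proof.
have dl := is_diff_affine p w t.
apply: DeriveDef; first exact/derivable1_diffP.
by rewrite deriveE // diff_val scale1r.
Qed.

Lemma linear_rV_continuous (R : realType) (n : nat) (W : normedModType R)
    (f : {linear 'rV[R]_n -> W}) : continuous f.
Proof.
have fE : f = (\sum_(i < n) (fun u : 'rV[R]_n => u 0 i *: f (delta_mx 0 i)))
    :> ('rV[R]_n -> W).
  apply/funext => u; rewrite {1}(row_sum_delta u) linear_sum fct_sumE.
  by apply: eq_bigr => i _; rewrite linearZ.
move=> u; apply: differentiable_continuous; rewrite fE.
apply: differentiable_sum => i.
exact/differentiableZl/differentiable_coord.
Qed.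

Lemma is_derive1_linear (R : realType) (n : nat) (W : normedModType R)
    (f : {linear 'rV[R]_n -> W}) (c : R -> 'rV[R]_n) (t : R) (a : 'rV[R]_n) :
  is_derive t 1 c a -> is_derive t 1 (f \o c) (f a).
Proof.
move=> ca; have fc := @linear_rV_continuous _ _ _ f.
rewrite -[X in is_derive _ _ _ X](_ : 'd f (c t) a = _); last by rewrite diff_lin.
by apply: is_derive1_comp ca; exact: linear_differentiable.
Qed.

(** Chart lines and tangent lines are curves of this form. The curve [c] is only
    required to agree with [G] on the line over [U]: the differential of [c] is
    given by that of [G] only there, so the induction on [k] needs this
    freedom. *)
Lemma Ck_affine (R : realType) (V W : normedModType R) (k : nat) (O : set V)
    (G : V -> W) (p w : V) (U : set R) (c : R -> W) :
  open U -> Ck k O G -> (forall t, U t -> O (p + t *: w)) ->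
  (forall t, U t -> c t = G (p + t *: w)) ->
  Ck k U c.
Proof.
move=> oU; pose l t : V := p + t *: w.
have dl t : is_diff t l ( *:%R ^~ w) by exact: is_diff_affine.
have near_c (f : R -> W) (G' : V -> W) t : U t ->
    (forall t, U t -> f t = G' (l t)) ->
    \near t, (G' \o l) t = f t.
  move=> Ut fE; have : nbhs t U by exact: open_nbhs_nbhs.
  by apply: filterS => s /fE.
elim: k G c => [|k IHk] G c /= CG OU cE.
  move=> t Ut; have Gt := CG _ (OU _ Ut).
  have ctE := near_c _ _ _ Ut cE.
  have Gl : {for t, continuous (G \o l)}.
    apply: continuous_comp; last exact: Gt.
    by apply: differentiable_continuous.
  rewrite /prop_for /continuous_at -(nbhs_singleton ctE).
  by apply: cvg_trans Gl; apply: near_eq_cvg.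
have [dG CdG] := CG.
have dc t : U t -> differentiable c t.
  move=> Ut; apply/derivable1_diffP/(near_eq_derivable (near_c _ _ _ Ut cE)).
  apply/derivable1_diffP/differentiable_comp => //.
  exact/dG/OU.
split=> // s; apply: (IHk _ _ (CdG (s *: w)) OU) => t Ut.
rewrite -deriveE; last exact: dc.
rewrite -(near_eq_derive s (near_c _ _ _ Ut cE)).
have dGt : differentiable G (l t) by exact/dG/OU.
rewrite deriveE; last exact: differentiable_comp.
by rewrite diff_comp //= (@diff_val _ _ _ _ _ _ _ (dl t)).
Qed.

Lemma smooth_id (R : realType) (V : normedModType R) (U : set V) :
  smooth U (id : V -> V).
Proof.
have Ccst k : forall a : V, Ck k U (fun _ => a).
  elim: k => [|k IHk] a /=; first by move=> x _; apply: cst_continuous.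
  split=> [x _|v]; first exact: differentiable_cst.
  have -> : (fun x => 'd (fun _ : V => a) x v) = (fun _ => 0 : V).
    by apply/funext => x; rewrite (diff_cst a).
  exact: IHk.
case=> [|k] /=; first by move=> x _; exact: cvg_id.
split=> [x _|v]; first exact: ex_diff.
have -> : (fun x => 'd (id : V -> V) x v) = (fun _ => v).
  by apply/funext => x; rewrite diff_val.
exact: Ccst.
Qed.

Lemma is_derive1_kernel (R : realType) (m n : nat) (K : 'M[R]_(m, n))
    (c : R -> 'rV[R]_m) (t : R) (a : 'rV[R]_m) :
  (\near t, c t *m K = 0) -> is_derive t 1 c a -> a *m K = 0.
Proof.
move=> cK ca; have dcK : is_derive t 1 (mulmxr K \o c) (a *m K).
  exact: (@is_derive1_linear _ _ _ (mulmxr K)).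
have dcst : is_derive t 1 (mulmxr K \o c) 0.
  apply: near_eq_is_derive (is_derive_cst 0 t 1).
  by move: cK; apply: filterS => s /= ->.
by rewrite -(@derive_val _ _ _ _ _ _ _ dcK) (@derive_val _ _ _ _ _ _ _ dcst).
Qed.

Lemma is_derive1_rowspace (R : realType) (m n : nat) (B : 'M[R]_(m, n))
    (c : R -> 'rV[R]_n) (t : R) (a : 'rV[R]_n) :
  (\near t, (c t <= B)%MS) -> is_derive t 1 c a -> (a <= B)%MS.
Proof.
move=> cB ca; rewrite submxE; apply/eqP/(is_derive1_kernel _ ca).
by apply: filterS cB => s; rewrite submxE => /eqP.
Qed.

(** * Tangent spaces *)

Lemma curve_through_near (R : realType) (n : nat) (M A : set 'rV[R]_n) x
    (c : R -> 'rV[R]_n) :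
  curve_through M x c -> relatively_open M A -> A x ->
  \forall t \near (0 : R), A (c t).
Proof.
move=> [c0 [e e0 [sc Mc]]] [S oS ->] [_ Sx].
have ball0 : nbhs (0 : R) (ball (0 : R) e) by exact: nbhsx_ballx.
have cc : {for 0, continuous c} by apply: (sc 0%N); exact: nbhs_singleton.
have cS : \forall t \near (0 : R), S (c t).
  by apply: cc; rewrite c0; exact: open_nbhs_nbhs.
by near=> t; split; [apply: Mc|]; near: t.
Unshelve. all: by end_near. Qed.

(** In a chart F with inverse G, v is tangent at x exactly when dF(x) v has zero
    last coordinates: along a curve on M these coordinates of F vanish, and
    conversely t |-> G (F x + t dF(x) v) is a smooth curve on M with velocity
    dG(F x) (dF(x) v) = v. *)
Lemma tangent_rowspace (R : realType) (n d : nat) (M : set 'rV[R]_n) x :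
  embedded_submanifold d M -> M x ->
  exists B : 'M[R]_n, tangent M x = [set v | (v <= B)%MS].
Proof.
move=> [_ /(_ x) chart] Mx.
have [S [W [F [G [[oS Sx oW] [[sF sG FS GW] MS]]]]]] := chart Mx.
(* D kills the first d coordinates, so on S the set M is the zero set of
   z |-> F z *m D. *)
pose D : 'M[R]_n := diag_mx (\row_j (d <= j)%N%:R).
have MD z : S z -> M z <-> F z *m D = 0.
  move=> /MS ->; split=> [F0|FD i di].
    apply/matrixP => i j; rewrite ord1 mul_mx_diag !mxE.
    by case: leqP => [/F0 ->|]; rewrite ?mul0r ?mulr0.
  move/matrixP/(_ 0 i): FD.
  by rewrite mul_mx_diag !mxE di mulr1.
have dF : differentiable F x by have [+ _] := sF 1%N; exact.
have dG : differentiable G (F x).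
  by have [+ _] := sG 1%N; apply; have [] := FS _ Sx.
exists (kermx (lin1_mx ('d F x) *m D)).
apply/seteqP; split=> v /=; rewrite (sameP sub_kermxP eqP) mulmxA mul_rV_lin1.
  move=> [c cM cv]; apply/eqP; have [c0 _] := cM.
  have dF0 : differentiable F (c 0) by rewrite c0.
  have := is_derive1_comp dF0 cv; rewrite c0; apply: is_derive1_kernel.
  have : \forall t \near (0 : R), (M `&` S) (c t).
    by apply: curve_through_near cM _ _; [exists S|split].
  by apply: filterS => t [Mt St]; exact/MD.
move=> /eqP wD; set w := 'd F x v in wD.
pose l (t : R) : 'rV[R]_n := F x + t *: w.
have dl : is_derive (0 : R) 1 l w by exact: is_derive1_affine.
have l0 : l 0 = F x by rewrite /l scale0r addr0.
have lW : nbhs (0 : R) (l @^-1` W).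
  have lc : {for 0, continuous l}.
    exact/differentiable_continuous/derivable1_diffP.
  apply: lc; rewrite l0; apply: open_nbhs_nbhs; split=> //.
  by have [] := FS _ Sx.
have /nbhs_ballP[e e0 leW] := lW.
exists (G \o l).
  split; first by rewrite /= l0; have [] := FS _ Sx.
  exists e => //; split.
    by move=> k; apply: (Ck_affine _ (sG k) leW) => //; exact: ball_open.
  move=> t /leW /GW [Olt FG]; apply/MD => //.
  rewrite /= FG mulmxDl -scalemxAl wD scaler0 addr0.
  exact/MD.
have dG0 : differentiable G (l 0) by rewrite l0.
have := is_derive1_comp dG0 dl.
rewrite l0; congr (is_derive _ _ _ _).
rewrite -[LHS]/(('d G (F x) \o 'd F x) v) -diff_comp //.
rewrite -deriveE; last exact: differentiable_comp.
rewrite -[RHS](derive_id x v); apply: near_eq_derive.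
have : nbhs x S by exact: open_nbhs_nbhs.
by apply: filterS => z /FS [].
Qed.

(** * Linear forms on a subspace *)

Definition linear_form_on (R : realType) (n : nat) (T : set 'rV[R]_n)
    (h : 'rV[R]_n -> R) :=
  forall (a : R) u v, T u -> T v -> h (a *: u + v) = a * h u + h v.

Lemma linear_form_on_mulmx (R : realType) (m n : nat) (B : 'M[R]_(m, n))
    (h : 'rV[R]_n -> R) (u : 'rV[R]_m) :
  linear_form_on [set v | (v <= B)%MS] h ->
  h (u *m B) = (u *m \col_i h (row i B)) 0 0.
Proof.
move=> hl; have h0 : h 0 = 0.
  have := hl 1 _ _ (sub0mx 1 B) (sub0mx 1 B).
  rewrite scaler0 addr0 mul1r => /esym/eqP.
  by rewrite -subr_eq0 addrK => /eqP.
rewrite mulmx_sum_row mxE.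
under [RHS]eq_bigr do rewrite mxE.
pose w : 'rV[R]_n := \sum_i u 0 i *: row i B.
suff [] : (w <= B)%MS /\ h w = \sum_i u 0 i * h (row i B) by [].
rewrite /w.
elim/big_rec2: _ => [|i y s _ [Bs <-]]; first by rewrite sub0mx.
by rewrite hl ?addmx_sub ?scalemx_sub //=; exact: row_sub.
Qed.

(** Nothing is known about [h] off the row space of [B], but there it agrees
    with a linear form of the whole space, and the curve stays in it. *)
Lemma is_derive1_linear_form_on (R : realType) (m n : nat) (B : 'M[R]_(m, n))
    (h : 'rV[R]_n -> R) (c : R -> 'rV[R]_n) (t : R) (a : 'rV[R]_n) :
  linear_form_on [set v | (v <= B)%MS] h -> (\near t, (c t <= B)%MS) ->
  is_derive t 1 c a -> is_derive t 1 (h \o c) (h a).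
Proof.
move=> hl cB ca; pose k := pinvmx B *m \col_i h (row i B).
have hE v : (v <= B)%MS -> h v = (v *m k) 0 0.
  by move=> vB; rewrite -{1}(mulmxKpV vB) linear_form_on_mulmx // -mulmxA.
pose hk : 'rV[R]_n -> R := fun v => (v *m k) 0 0.
have hkl : linear hk by move=> b u v; rewrite /hk mulmxDl -scalemxAl !mxE.
pose hkM := GRing.isLinear.Build _ _ _ _ _ hkl.
pose hkL : {linear 'rV[R]_n -> R} := HB.pack hk hkM.
rewrite hE; last exact: is_derive1_rowspace ca.
apply: near_eq_is_derive (is_derive1_linear hkL ca).
by apply: filterS cB => s /hE.
Qed.

(** The Gram matrix of a basis is invertible because the form is definite, so
    the values of [h] on the basis can be prescribed. *)
Lemma rowspace_riesz (R : realType) (n : nat) (B : 'M[R]_n)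
    (T := [set v : 'rV[R]_n | (v <= B)%MS])
    (g : 'rV[R]_n -> 'rV[R]_n -> R) (h : 'rV[R]_n -> R) :
  inner_product_on T g -> linear_form_on T h ->
  exists2 G, T G & forall v, T v -> g G v = h v.
Proof.
have -> : T = [set v | (v <= row_base B)%MS].
  by apply/funext => v; rewrite /T /= eq_row_base.
have : row_free (row_base B) by exact: row_base_free.
move: (row_base B) => C freeC [gl gC gp] hl.
have uCC (u : 'rV_(\rank B)) : (u *m C <= C)%MS by exact: submxMl.
pose N := \matrix_(i, j) g (row i C) (row j C).
have glin u : (u <= C)%MS -> linear_form_on [set w | (w <= C)%MS] (g u).
  move=> uC a v1 v2 v1C v2C; rewrite gC // ?gl // ?[g u _]gC //.
  by rewrite /= addmx_sub ?scalemx_sub.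
have gN u j : g (u *m C) (row j C) = (u *m N) 0 j.
  rewrite (linear_form_on_mulmx u (h := g ^~ (row j C))).
    by rewrite !mxE; apply: eq_bigr => i _; rewrite !mxE.
  by move=> a v w vC wC; rewrite gl //; exact: row_sub.
have gE u v : (v <= C)%MS -> (forall j, g (u *m C) (row j C) = h (row j C)) ->
    g (u *m C) v = h v.
  move=> /submxP[z ->] gh; rewrite !linear_form_on_mulmx //; last exact: glin.
  by congr ((_ *m _) 0 0); apply/colP => i; rewrite !mxE gh.
have uN : N \in unitmx.
  rewrite -row_free_unit; apply: inj_row_free => u uN0.
  apply/(row_free_inj freeC)/eqP; rewrite mul0mx; apply/negPn/negP.
  move=> /(gp _ (uCC u)); rewrite linear_form_on_mulmx; last exact/glin/uCC.
  have -> : \col_i g (u *m C) (row i C) = 0.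
    by apply/colP => i; rewrite !mxE gN uN0 mxE.
  by rewrite mulmx0 mxE ltxx.
pose z := (\row_j h (row j C)) *m invmx N.
exists (z *m C) => [|v vC]; first exact: uCC.
by apply: gE => // j; rewrite gN mulmxKV // mxE.
Qed.

(** * Gradients *)

Lemma grad_is_gradient (R : realType) (n d : nat) (M : set 'rV[R]_n)
    (g : 'rV[R]_n -> 'rV[R]_n -> 'rV[R]_n -> R) (f : 'rV[R]_n -> R) x :
  embedded_submanifold d M -> riemannian_metric M g -> C1_on M f -> M x ->
  is_gradient M g f x (grad M g f x).
Proof.
move=> Md [gip _] fC1 Mx.
have [S [F [oS Sx [dF _] Ff]]] := fC1 _ Mx.
have dFx := dF _ Sx.
have [B TB] := tangent_rowspace Md Mx.
have [G TG gG] : exists2 G, tangent M x G &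
    forall v, tangent M x v -> g x G v = 'd F x v.
  rewrite TB; apply: rowspace_riesz => [|a u v _ _]; last by rewrite linearP.
  by rewrite -TB; apply: gip.
apply: (@xgetPex _ _ (is_gradient M g f x)); exists G; split=> // c v cM cv.
rewrite gG; last by exists c.
have [c0 _] := cM; have dFc : differentiable F (c 0) by rewrite c0.
have := is_derive1_comp dFc cv; rewrite c0; apply: near_eq_is_derive.
have : \forall t \near (0 : R), (M `&` S) (c t).
  by apply: curve_through_near cM _ _; [exists S|split].
by apply: filterS => t [Mt St]; rewrite /= Ff.
Qed.

Lemma is_gradient_unique (R : realType) (n d : nat) (M : set 'rV[R]_n)
    (g : 'rV[R]_n -> 'rV[R]_n -> 'rV[R]_n -> R) (f : 'rV[R]_n -> R) x G G' :
  embedded_submanifold d M -> riemannian_metric M g -> M x ->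
  is_gradient M g f x G -> is_gradient M g f x G' -> G = G'.
Proof.
move=> Md [/(_ x) gip _] Mx [TG fG] [TG' fG']; have [gl _ gp] := gip Mx.
have gGG' v : tangent M x v -> g x G v = g x G' v.
  move=> [c cM cv].
  rewrite -(@derive_val _ _ _ _ _ _ _ (fG _ _ cM cv)).
  by rewrite -(@derive_val _ _ _ _ _ _ _ (fG' _ _ cM cv)).
have TD : tangent M x (-1 *: G' + G).
  have [B TB] := tangent_rowspace Md Mx.
  by move: TG TG'; rewrite TB /= => *; rewrite addmx_sub ?scalemx_sub.
apply/eqP; rewrite -subr_eq0 addrC -scaleN1r; apply/negPn/negP => /(gp _ TD).
by rewrite gl // gGG' // mulN1r addNr ltxx.
Qed.

(** This covers the default value 0 taken by [grad] when there is no
    gradient. *)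
Lemma grad_tangent (R : realType) (n d : nat) (M : set 'rV[R]_n)
    (g : 'rV[R]_n -> 'rV[R]_n -> 'rV[R]_n -> R) (f : 'rV[R]_n -> R) x :
  embedded_submanifold d M -> M x -> tangent M x (grad M g f x).
Proof.
move=> Md Mx; rewrite /grad; case: xgetP => [G _ []//|_].
by have [B ->] := tangent_rowspace Md Mx; exact: sub0mx.
Qed.

(** * The differential of the lifting *)

(** Let c be a curve through y with velocity v, and a the velocity of its lift
    L_y \o c, a curve in the tangent space at y. Locally R_y is a
    differentiable map H, and H \o (L_y \o c) = c gives dH(0) a = v. As a is
    tangent, the condition on the differential of R_y at 0 applies to the
    line t |-> t a and gives dH(0) a = a. Testing R_y on this line instead of
    on the lift avoids having to show that the lift is smooth. *)
Lemma lifting_differential (R : realType) (n d : nat) (M : set 'rV[R]_n)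
    (Ret : 'rV[R]_n -> 'rV[R]_n -> 'rV[R]_n) (U : 'rV[R]_n -> set 'rV[R]_n)
    (L : 'rV[R]_n -> 'rV[R]_n -> 'rV[R]_n) y :
  embedded_submanifold d M -> retraction M Ret -> lifting M Ret U L -> M y ->
  has_differential M (L y) y id.
Proof.
move=> Md rR lL My c v cM cv.
have [D [[[Q oQ DE] D0 oU Uy] [LR RL sL]]] := lL _ My.
have [_ sR R0 dR] := rR _ My.
have [B TB] := tangent_rowspace Md My.
have T0 : tangent M y 0 by rewrite TB; exact: sub0mx.
have L0 : L y y = 0 by rewrite -{2}R0; apply: (LR _ D0).2.
have LT z : U y z -> tangent M y (L y z).
  by move=> /RL[]; rewrite DE => -[].
have [c0 _] := cM.
have cU : \forall t \near (0 : R), U y (c t) by exact: curve_through_near cM _ _.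
have [S [F [oS Sy sF FL]]] := sL _ Uy.
have [+ _] := sF 1%N => /(_ _ Sy) dF.
have cS : \forall t \near (0 : R), (M `&` S) (c t).
  by apply: curve_through_near cM _ _; [exists S|split].
have LcF : \forall t \near (0 : R), F (c t) = L y (c t).
  near=> t; apply: FL; last by near: t.
  by have [] : (M `&` S) (c t) by near: t.
set a := 'd F y v.
have dLc : is_derive (0 : R) 1 (L y \o c) a.
  have dF0 : differentiable F (c 0) by rewrite c0.
  by have := is_derive1_comp dF0 cv; rewrite c0; apply: near_eq_is_derive.
have Ta : tangent M y a.
  rewrite TB; apply: is_derive1_rowspace dLc.
  by apply: filterS cU => t /LT; rewrite TB.
have [W [H [oW W0 sH HR]]] := sR _ T0.
have [+ _] := sH 1%N => /(_ _ W0) dH.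
have dHa : 'd H 0 a = v.
  have dHc : differentiable H ((L y \o c) 0) by rewrite /= c0 L0.
  have := is_derive1_comp dHc dLc; rewrite /= c0 L0 => dHLc.
  rewrite -(@derive_val _ _ _ _ _ _ _ dHLc) -(@derive_val _ _ _ _ _ _ _ cv).
  apply: near_eq_derive.
  have Lcc : {for 0, continuous (L y \o c)}.
    exact/differentiable_continuous/derivable1_diffP.
  have LcW : \forall t \near (0 : R), W (L y (c t)).
    by apply: Lcc; rewrite /= c0 L0; exact: open_nbhs_nbhs.
  near=> t; have Ut : U y (c t) by near: t.
  rewrite /= HR; [exact: (RL _ Ut).2|near: t; exact: LcW|exact: LT].
pose l (t : R) : 'rV[R]_n := 0 + t *: a.
have l0 : l 0 = 0 by rewrite /l scale0r addr0.
have lT t : tangent M y (l t).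
  by move: Ta; rewrite TB /= /l add0r => ?; rewrite scalemx_sub.
have dl : is_derive (0 : R) 1 l a by exact: is_derive1_affine.
have lcurve : curve_through (tangent M y) 0 l.
  split=> //; exists 1 => //; split=> // k.
  by apply: (Ck_affine (G := id) _ (smooth_id setT k)) => //; exact: ball_open.
have dHl : differentiable H (l 0) by rewrite l0.
have := is_derive1_comp dHl dl; rewrite l0 dHa => Hl.
have /(@derive_val _ _ _ _ _ _ _) Rl := dR _ _ lcurve dl.
suff <- : a = v by [].
rewrite -[LHS]Rl -(@derive_val _ _ _ _ _ _ _ Hl).
apply: near_eq_derive.
have lW : \forall t \near (0 : R), (tangent M y `&` W) (l t).
  by apply: curve_through_near lcurve _ _; [exists W|split].
by apply: filterS lW => t [Tt Wt]; rewrite /= HR.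
Unshelve. all: by end_near. Qed.

(** * The gradient of the coarse model *)

Theorem proposition3p2 (R : realType) (nH nh dH dh : nat)
  (MH : set 'rV[R]_nH) (gH : 'rV[R]_nH -> 'rV[R]_nH -> 'rV[R]_nH -> R)
  (Mh : set 'rV[R]_nh) (gh : 'rV[R]_nh -> 'rV[R]_nh -> 'rV[R]_nh -> R)
  (fH : 'rV[R]_nH -> R) (fh : 'rV[R]_nh -> R)
  (Ret : 'rV[R]_nH -> 'rV[R]_nH -> 'rV[R]_nH)
  (U : 'rV[R]_nH -> set 'rV[R]_nH)
  (L : 'rV[R]_nH -> 'rV[R]_nH -> 'rV[R]_nH)
  (x : 'rV[R]_nh) (y : 'rV[R]_nH) (Cy : set 'rV[R]_nH)
  (P : 'rV[R]_nH -> 'rV[R]_nh) (Q : 'rV[R]_nh -> 'rV[R]_nH) :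
  embedded_submanifold dH MH -> riemannian_metric MH gH ->
  embedded_submanifold dh Mh -> riemannian_metric Mh gh ->
  C1_on MH fH -> C1_on Mh fh ->
  retraction MH Ret -> lifting MH Ret U L ->
  Mh x -> MH y ->
  Cy `<=` MH -> Cy y -> retraction_convex Ret U L Cy -> Cy `<=` U y ->
  vector_transfer (tangent MH y) (gH y) (tangent Mh x) (gh x) P Q ->
  let q := coarse_objective MH gH fH L Mh gh fh Q x y in
  is_gradient MH gH q y (Q (grad Mh gh fh x)) /\
  grad MH gH q y = Q (grad Mh gh fh x).
Proof.
move=> MHd gHm Mhd _ fC1 _ rR lL xMh yMH _ _ _ _ [_ _ [QT _] _ _] q.
set r := Q (grad Mh gh fh x).
suff qr : is_gradient MH gH q y r.
  split=> //; apply: (is_gradient_unique MHd gHm yMH _ qr).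
  by apply: (@xgetPex _ _ (is_gradient MH gH q y)); exists r.
have Tr : tangent MH y r by apply: QT; exact: grad_tangent Mhd xMh.
have [TG fG] := grad_is_gradient MHd gHm fC1 yMH.
set G := grad MH gH fH y in TG fG.
have [gl gC _] := gHm.1 _ yMH.
have [B TB] := tangent_rowspace MHd yMH.
split=> // c v cM cv.
have Tv : tangent MH y v by exists c.
have Tw : tangent MH y (G - r).
  by move: TG Tr; rewrite TB /= => *; rewrite addmx_sub // eqmx_opp.
have wl : linear_form_on [set u | (u <= B)%MS] (gH y (G - r)).
  rewrite -TB => a u1 u2 T1 T2; have T12 : tangent MH y (a *: u1 + u2).
    by move: T1 T2; rewrite TB /= => *; rewrite addmx_sub ?scalemx_sub.
  by rewrite gC // gl // ![gH y (G - r) _]gC.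
have LcT : \forall t \near (0 : R), (L y (c t) <= B)%MS.
  have [D [[[Z _ DE] _ oU Uy] [_ RL _]]] := lL _ yMH.
  apply: filterS (curve_through_near cM oU Uy) => t /RL[+ _].
  by rewrite DE TB => -[].
have dw := is_derive1_linear_form_on wl LcT
  (lifting_differential MHd rR lL yMH cM cv).
have := is_deriveB (fG _ _ cM cv) dw.
rewrite -[X in is_derive _ _ _ X -> _](_ : gH y r v = _) //.
rewrite -{1}(addrK (G - r) r) [r + _]addrC subrK -scaleN1r addrC gl //.
by rewrite mulN1r addrC.
Qed.
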